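(* Let $a$ and $b$ be positive integers with $\gcd(a,b)=1$ and $b$ odd. If $3 \mid b$ and $4 \nmid a$, then the torsion subgroup of $E_{a,b}(\mathbb{Q})$, where $E_{a,b}$ is the elliptic curve $y^{2} = x^{3} - a^{2}x + b^{2}$, is trivial. Moreover, there exist infinitely many pairs of positive integers $(a,b)$ with $a^{2} = 3b^{2}+1$ such that the Mordell-Weil rank of $E_{a,b}(\mathbb{Q})$ is at least $3$ and $E_{a,b}(\mathbb{Q})_{\mathrm{tors}}$ is trivial.
   Context: For an elliptic curve $E$ over $\mathbb{Q}$, $E(\mathbb{Q}) \cong \mathbb{Z}^r \oplus E(\mathbb{Q})_{\mathrm{tors}}$ by the Mordell-Weil theorem; $r$ is the Mordell-Weil rank and $E(\mathbb{Q})_{\mathrm{tors}}$ the torsion subgroup. *)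

(* Defs.v *)
From HB Require Import structures.
From mathcomp Require Import all_boot all_order all_algebra.
Set Implicit Arguments. Unset Strict Implicit. Unset Printing Implicit Defensive.
Import Order.TTheory GRing.Theory Num.Theory.
Local Open Scope ring_scope.

(* A projective point: None is the point at infinity O, Some (x,y) affine. *)
Definition point := option (rat * rat).

Definition on_curve (A B : rat) (P : point) : bool :=
  match P with
  | None => true
  | Some (x, y) => y ^+ 2 == x ^+ 3 + A * x + B
  end.

Definition ec_neg (P : point) : point :=
  match P with None => None | Some (x, y) => Some (x, - y) end.

Definition ec_add (A : rat) (P Q : point) : point :=
  match P, Q with
  | None, _ => Q
  | _, None => P
  | Some (x1, y1), Some (x2, y2) =>
      if (x1 == x2) && (y1 == - y2) then None
      else
        let l := if x1 == x2 then (3 * x1 ^+ 2 + A) / (2 * y1)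
                 else (y2 - y1) / (x2 - x1) in
        let x3 := l ^+ 2 - x1 - x2 in
        Some (x3, l * (x1 - x3) - y1)
  end.

Definition ec_natmul (A : rat) (n : nat) (P : point) : point :=
  iter n (ec_add A P) None.

Definition ec_intmul (A : rat) (m : int) (P : point) : point :=
  match m with
  | Posz n => ec_natmul A n P
  | Negz n => ec_neg (ec_natmul A n.+1 P)
  end.

Definition torsion_trivial (A B : rat) : Prop :=
  forall P : point, on_curve A B P ->
    (exists n : nat, (0 < n)%N /\ ec_natmul A n P = None) -> P = None.

Definition rank_ge3 (A B : rat) : Prop :=
  exists P1 P2 P3 : point,
    [/\ on_curve A B P1, on_curve A B P2, on_curve A B P3 &
    forall n1 n2 n3 : int,
      ec_add A (ec_intmul A n1 P1)
        (ec_add A (ec_intmul A n2 P2) (ec_intmul A n3 P3)) = None ->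
      [/\ n1 = 0, n2 = 0 & n3 = 0]].

Definition Ecoef_A (a : nat) : rat := - (a%:R ^+ 2).
Definition Ecoef_B (b : nat) : rat := b%:R ^+ 2.

(* Main.v *)
Require Import Defs.
From HB Require Import structures.
From mathcomp Require Import all_boot all_order all_algebra.
From mathcomp Require Import ring lra zify.
Set Implicit Arguments. Unset Strict Implicit. Unset Printing Implicit Defensive.
Import Order.TTheory GRing.Theory Num.Theory.
Local Open Scope ring_scope.

(** Torsion: modulo 3 the curve becomes [y^2 = x^3 - x], whose four points over
    [F_3] are killed by 2, so every double [2 Q] reduces to the point at infinity,
    that is, 3 divides the denominator of [x(2 Q)].  The tripling formula shows that
    for such a point [R] the 3-adic valuation of the denominator of [x(3 R)] is
    larger than that of [x(R)], so [R] is not torsion.  Hence a torsion point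
    satisfies [2 P = O], and there is no rational point of order 2: its abscissa [u]
    would be an integer with [u (a^2 - u^2) = b^2] and coprime factors, hence plus
    or minus a square, which is impossible modulo 8.

    Rank: if [a^2 = 3 b^2 + 1], the points [(0, b)], [(a, b)], [(-1, 2 b)] lie on the
    curve.  Without 2-torsion they are independent as soon as no nonzero combination
    with coefficients in {0, 1} is a double.  When [a = 2] modulo 3, six of the seven
    combinations do not reduce to infinity modulo 3; the seventh has a negative
    abscissa, whereas doubles have positive abscissas.  Cubing [a + b sqrt 3]
    produces infinitely many suitable pairs from [(26, 15)]. *)

(** * Lines meeting the cubic, counted with multiplicity *)

Definition wpoly (A B : rat) : {poly rat} := 'X ^+ 3 + A%:P * 'X + B%:P.

Definition aff (l m : rat) : {poly rat} := l%:P * 'X + m%:P.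

(** Stated as a polynomial identity, so that multiplicities are recorded and tangents need no
    separate case. *)
Definition line3 (A B x1 y1 x2 y2 x3 y3 : rat) : Prop :=
  exists l m : rat, [/\ y1 = l * x1 + m, y2 = l * x2 + m, y3 = l * x3 + m &
    wpoly A B - aff l m ^+ 2 = ('X - x1%:P) * ('X - x2%:P) * ('X - x3%:P)].

Lemma line3_rot A B x1 y1 x2 y2 x3 y3 :
  line3 A B x1 y1 x2 y2 x3 y3 -> line3 A B x2 y2 x3 y3 x1 y1.
Proof. by move=> [l [m [? ? ? e]]]; exists l, m; split=> //; rewrite e; ring. Qed.

Lemma line3_swap A B x1 y1 x2 y2 x3 y3 :
  line3 A B x1 y1 x2 y2 x3 y3 -> line3 A B x2 y2 x1 y1 x3 y3.
Proof. by move=> [l [m [? ? ? e]]]; exists l, m; split=> //; rewrite e; ring. Qed.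

Lemma line3_opp A B x1 y1 x2 y2 x3 y3 :
  line3 A B x1 y1 x2 y2 x3 y3 -> line3 A B x1 (- y1) x2 (- y2) x3 (- y3).
Proof.
move=> [l [m [-> -> -> e]]]; exists (- l), (- m); split; try ring.
by rewrite -e /aff; ring.
Qed.

Lemma line3_coefP A B l m x1 x2 x3 :
  wpoly A B - aff l m ^+ 2 = ('X - x1%:P) * ('X - x2%:P) * ('X - x3%:P) <->
  [/\ l ^+ 2 = x1 + x2 + x3, A - 2 * l * m = x1 * x2 + x2 * x3 + x1 * x3 &
      m ^+ 2 - B = x1 * x2 * x3].
Proof.
split=> [e|[e1 e2 e3]]; last first.
  have -> : A = x1 * x2 + x2 * x3 + x1 * x3 + 2 * l * m by rewrite -e2; ring.
  have -> : B = m ^+ 2 - x1 * x2 * x3 by rewrite -e3; ring.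
  have -> : x3 = l ^+ 2 - x1 - x2 by rewrite e1; ring.
  by rewrite /wpoly /aff; ring.
have h t : t ^+ 3 + A * t + B - (l * t + m) ^+ 2 = (t - x1) * (t - x2) * (t - x3).
  by move/(congr1 (fun p => p.[t])): e; rewrite /wpoly /aff !hornerE.
(* The values at a few points determine the coefficients linearly. *)
have := (h 0, h 1, h (-1), h 2) => -[[[h0 h1] h2] h3].
split; lra.
Qed.

(** * The group law *)

Section GroupLaw.
Variables A B : rat.
Hypothesis ns : 4 * A ^+ 3 + 27 * B ^+ 2 != 0.

Lemma ec_add_line x1 y1 x2 y2 x3 y3 :
  line3 A B x1 y1 x2 y2 x3 y3 ->
  ec_add A (Some (x1, y1)) (Some (x2, y2)) = Some (x3, - y3).
Proof.
move=> [l [m [-> -> -> /line3_coefP [e1 e2 e3]]]] /=.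
have x3E : x3 = l ^+ 2 - x1 - x2 by rewrite e1; ring.
have [ex|nx] := eqVneq x1 x2; last first.
  have -> /= : (l * x2 + m - (l * x1 + m)) / (x2 - x1) = l.
    by field; rewrite subr_eq0 eq_sym.
  by rewrite x3E; congr Some; congr pair; ring.
subst x2.
have [y0|y0] := eqVneq (l * x1 + m) (- (l * x1 + m)) => /=.
  (* A non-vertical line meeting the curve twice at a point with [y = 0] makes [x1] a double root of
     the cubic, against [ns]. *)
  have mE : m = - (l * x1) by lra.
  case/eqP: ns.
  have AE : A = - (3 * x1 ^+ 2).
    have -> : A = x1 * x1 + x1 * x3 + x1 * x3 + 2 * l * m by rewrite -e2; ring.
    by rewrite x3E mE; ring.
  have BE : B = 2 * x1 ^+ 3.
    have -> : B = m ^+ 2 - x1 * x1 * x3 by rewrite -e3; ring.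
    by rewrite x3E mE; ring.
  by rewrite AE BE; ring.
have y0' : l * x1 + m != 0 by apply: contra_neq y0; lra.
have -> /= : (3 * x1 ^+ 2 + A) / (2 * (l * x1 + m)) = l.
  have -> : A = x1 * x1 + x1 * x3 + x1 * x3 + 2 * l * m by rewrite -e2; ring.
  by rewrite x3E; field.
by rewrite x3E; congr Some; congr pair; ring.
Qed.

Lemma line_ec_add x1 y1 x2 y2 x3 y3 :
  on_curve A B (Some (x1, y1)) -> on_curve A B (Some (x2, y2)) ->
  ec_add A (Some (x1, y1)) (Some (x2, y2)) = Some (x3, y3) ->
  line3 A B x1 y1 x2 y2 x3 (- y3).
Proof.
move=> /= /eqP c1 /eqP c2.
have [ex|nx] := eqVneq x1 x2; last first.
  move=> /= -[<- <-].
  have dn0 : x2 - x1 != 0 by rewrite subr_eq0 eq_sym.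
  set l := (y2 - y1) / (x2 - x1).
  have lE : y2 = y1 + l * (x2 - x1) by rewrite /l; field.
  exists l, (y1 - l * x1); split; first ring.
  - by rewrite lE; ring.
  - by ring.
  have h1 : B = y1 ^+ 2 - x1 ^+ 3 - A * x1 by rewrite c1; ring.
  (* Dividing the difference of the two curve equations by [x2 - x1] expresses [A] through the
     slope. *)
  have h2 : A = l * (y1 + y2) - (x1 ^+ 2 + x1 * x2 + x2 ^+ 2).
    apply: (mulfI dn0).
    have h : (x2 - x1) * A = y2 ^+ 2 - y1 ^+ 2 - (x2 ^+ 3 - x1 ^+ 3) by rewrite c1 c2; ring.
    by rewrite h [in LHS]lE [in RHS]lE; ring.
  apply/line3_coefP; split; first ring.
  - by rewrite h2 lE; ring.
  - by rewrite h1 h2 lE; ring.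
subst x2; have [//|y12] /= := eqVneq y1 (- y2).
have e12 : y1 = y2.
  have : (y1 - y2) * (y1 + y2) = 0 by rewrite -subr_sqr c1 c2; ring.
  move/eqP; rewrite mulf_eq0 subr_eq0 addr_eq0 (negbTE y12) orbF.
  by move/eqP.
subst y2; move=> -[<- <-].
have y0 : y1 != 0 by apply: contra_neq y12 => ->; rewrite oppr0.
set l := _ / (2 * y1).
have h2 : A = 2 * y1 * l - 3 * x1 ^+ 2 by rewrite /l; field.
have h1 : B = y1 ^+ 2 - x1 ^+ 3 - A * x1 by rewrite c1; ring.
exists l, (y1 - l * x1); split; try ring.
apply/line3_coefP; split; first ring.
- by rewrite h2; ring.
- by rewrite h1 h2; ring.
Qed.

Lemma ec_add_curve P Q : on_curve A B P -> on_curve A B Q ->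
  on_curve A B (ec_add A P Q).
Proof.
case: P => [[x1 y1]|//] cP; case: Q => [[x2 y2]|//] cQ.
case E : (ec_add _ _ _) => [[x3 y3]|//].
have [l [m [_ _ e /line3_coefP [e1 e2 e3]]]] := line_ec_add cP cQ E.
apply/eqP; rewrite -sqrrN e.
have -> : A = x1 * x2 + x2 * x3 + x1 * x3 + 2 * l * m by rewrite -e2; ring.
have -> : B = m ^+ 2 - x1 * x2 * x3 by rewrite -e3; ring.
by rewrite sqrrD exprMn e1; ring.
Qed.

Lemma ec_neg_curve P : on_curve A B P -> on_curve A B (ec_neg P).
Proof. by case: P => [[x y]|//] /=; rewrite sqrrN. Qed.

Lemma ec_add0 P : ec_add A P None = P. Proof. by case: P => [[]|]. Qed.

Lemma ec_negK : involutive ec_neg.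
Proof. by case=> [[x y]|//] /=; rewrite opprK. Qed.

Lemma ec_addN P : ec_add A (ec_neg P) P = None.
Proof. by case: P => [[x y]|//] /=; rewrite !eqxx. Qed.

Lemma ec_add_eq0 P Q : ec_add A P Q = None -> Q = ec_neg P.
Proof.
case: P => [[x1 y1]|]; case: Q => [[x2 y2]|] //=.
by case: ifP => // /andP [/eqP -> /eqP ->] _; rewrite opprK.
Qed.

Lemma ec_addC P Q : on_curve A B P -> on_curve A B Q ->
  ec_add A P Q = ec_add A Q P.
Proof.
move=> cP cQ; case E : (ec_add A P Q) => [R|]; last first.
  by rewrite (ec_add_eq0 E) ec_addN.
case: P cP E => [[x1 y1]|//]; last by rewrite /= ec_add0 => _ [->].
case: Q cQ => [[x2 y2]|//] cQ cP; case: R => x3 y3 E.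
have /line3_swap/ec_add_line -> := line_ec_add cP cQ E.
by rewrite opprK.
Qed.

(** The line through [P], [Q], [-(P + Q)], reflected in the x-axis, passes through [-P], [P + Q],
    [-Q]. *)
Lemma ec_addKN P Q : on_curve A B P -> on_curve A B Q ->
  ec_add A (ec_neg P) (ec_add A P Q) = Q.
Proof.
case: P => [[x1 y1]|//] cP; case: Q => [[x2 y2]|] cQ; last by rewrite ec_add0 ec_addN.
case E : (ec_add _ (Some _) (Some _)) => [[x3 y3]|].
  have /line3_rot/line3_rot/line3_swap/line3_opp/ec_add_line := line_ec_add cP cQ E.
  by rewrite !opprK.
by rewrite ec_add0 (ec_add_eq0 E).
Qed.

(* [L1], [L2], [L3] are the lines through [P, Q, -S], [S, R, -U], [Q, R, -T].
   The function [q - c y], with [q] as below, has divisor [P + Q + R - U - 2 O],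
   and multiplying it by [y + L3] shows that [c (X - xT) - L3] is the line
   through [P], [T] and [-U]. *)
Lemma line3_assoc x1 y1 x2 y2 x3 y3 xS yS xT yT xU yU :
  line3 A B x1 y1 x2 y2 xS (- yS) -> line3 A B xS yS x3 y3 xU (- yU) ->
  line3 A B x2 y2 x3 y3 xT (- yT) ->
  (x2 != x3) || ((y2 == y3) && (x2 != xS)) ->
  line3 A B x1 y1 xT yT xU (- yU).
Proof.
move=> [l1 [m1 [y1E y2E ySE f1]]] [l2 [m2 [ySE' y3E yUE f2]]].
move=> [l3 [m3 [y2E' y3E' yTE f3]]] ne.
pose c := l1 + l2.
pose L1 := aff l1 m1; pose L2 := aff l2 m2; pose L3 := aff l3 m3.
pose q := ('X - x1%:P) * ('X - x2%:P) + c%:P * L1.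
have m12 : m2 = - c * xS - m1 by rewrite /c; lra.
have L12 : L1 + L2 = c%:P * ('X - xS%:P).
  by rewrite /L1 /L2 /aff m12 /c; ring.
have fne a : ('X - a%:P : {poly rat}) != 0 by rewrite polyXsubC_eq0.
(* Both sides multiplied by [X - xS] become [wpoly A B + L1 * L2], which is symmetric in the two
   lines. *)
have qE : q = ('X - x3%:P) * ('X - xU%:P) + c%:P * L2.
  apply: (mulfI (fne xS)); rewrite /q.
  have -> : ('X - xS%:P) * (('X - x3%:P) * ('X - xU%:P) + c%:P * L2)
    = wpoly A B - L2 ^+ 2 + L2 * (c%:P * ('X - xS%:P)) by rewrite f2; ring.
  have -> : ('X - xS%:P) * (('X - x1%:P) * ('X - x2%:P) + c%:P * L1)
    = wpoly A B - L1 ^+ 2 + L1 * (c%:P * ('X - xS%:P)) by rewrite f1; ring.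
  by rewrite -L12; ring.
have q3 : q - c%:P * L3 = ('X - x2%:P) * ('X - x3%:P).
  have m13 : m1 = (l3 - l1) * x2 + m3 by lra.
  have L13 : L1 - L3 = (l1 - l3)%:P * ('X - x2%:P).
    by rewrite /L1 /L3 /aff m13; ring.
  (* [X - x2] divides [q - c L3] because [L1] and [L3] agree at [x2]; only the other root remains to
     be found. *)
  suff k : x3 = x1 - c * (l1 - l3).
    have -> : q - c%:P * L3 = ('X - x1%:P) * ('X - x2%:P) + c%:P * (L1 - L3).
      by rewrite /q; ring.
    by rewrite L13 k; ring.
  have [e|ne23] := eqVneq x2 x3; last first.
    apply: (mulfI (x := x3 - x2)); first by rewrite subr_eq0 eq_sym.
    move/(congr1 (fun p => p.[x3])): qE.
    rewrite /q /L1 /L2 /aff !hornerE /= subrr mul0r add0r -y3E y3E' => h.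
    rewrite m13 in h; lra.
  (* Tangent case [Q = R]: the missing relation comes from [f1] and [f3], subtracted, divided by
     [X - x2] and evaluated at [x2]. *)
  move: ne; rewrite e eqxx /= => /andP [/eqP y23 neS]; subst x3 y3.
  have dn0 : x2 - xS != 0 by rewrite subr_eq0.
  have cE : c * (x2 - xS) = 2 * y2.
    have := congr1 (fun p => p.[x2]) L12; rewrite /L1 /L2 /aff !hornerE /=; lra.
  have k : (L1 + L3) * (l1 - l3)%:P =
      ('X - x2%:P) * ('X - xT%:P) - ('X - x1%:P) * ('X - xS%:P).
    apply: (mulfI (fne x2)).
    have -> : ('X - x2%:P) * ((L1 + L3) * (l1 - l3)%:P) =
      (wpoly A B - L3 ^+ 2) - (wpoly A B - L1 ^+ 2).
      by rewrite mulrCA [('X - _) * _]mulrC -L13; ring.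
    by rewrite f1 f3; ring.
  apply: (mulfI dn0).
  have k2 : 2 * y2 * (l1 - l3) = - ((x2 - x1) * (x2 - xS)).
    have -> : 2 * y2 = (L1 + L3).[x2] by rewrite !hornerE /=; lra.
    by rewrite -[l1 - l3](hornerC _ x2) -hornerM k !hornerE /=; ring.
  have -> : (x2 - xS) * (x1 - c * (l1 - l3)) =
     (x2 - xS) * x1 - (c * (x2 - xS)) * (l1 - l3) by ring.
  by rewrite cE; lra.
(* Both sides multiplied by [(X - x2)(X - x3)] equal [q^2 - c^2 wpoly], the norm of [q - c y]. *)
have W : ('X - x2%:P) * ('X - x3%:P) + 2 * c%:P * L3 - c%:P ^+ 2 * ('X - xT%:P)
    = ('X - x1%:P) * ('X - xU%:P).
  apply: (mulfI (mulf_neq0 (fne x2) (fne x3))).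
  have -> : ('X - x2%:P) * ('X - x3%:P) *
     (('X - x2%:P) * ('X - x3%:P) + 2 * c%:P * L3 - c%:P ^+ 2 * ('X - xT%:P))
   = (q - c%:P * L3) * (q + c%:P * L3) - c%:P ^+ 2 * (wpoly A B - L3 ^+ 2).
    by rewrite f3 -q3; ring.
  have -> : ('X - x2%:P) * ('X - x3%:P) * (('X - x1%:P) * ('X - xU%:P)) =
     (('X - x1%:P) * ('X - x2%:P)) * (('X - x3%:P) * ('X - xU%:P)) by ring.
  have -> : ('X - x3%:P) * ('X - xU%:P) = q - c%:P * L2 by rewrite qE; ring.
  have -> : L2 = c%:P * ('X - xS%:P) - L1 by rewrite -L12; ring.
  have -> : ('X - x1%:P) * ('X - x2%:P) * (q - c%:P * (c%:P * ('X - xS%:P) - L1))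
   = ('X - x1%:P) * ('X - x2%:P) * (q + c%:P * L1) - c%:P ^+ 2 * (wpoly A B - L1 ^+ 2).
    by rewrite f1; ring.
  have -> : ('X - x1%:P) * ('X - x2%:P) = q - c%:P * L1 by rewrite /q; ring.
  by ring.
have L4E : aff (c - l3) (- c * xT - m3) = c%:P * ('X - xT%:P) - L3.
  by rewrite /aff /L3 /aff; ring.
have onL t y : q.[t] = c * y -> (t - x1) * (t - xU) = 0 -> c != 0 ->
    y = (c - l3) * t + (- c * xT - m3).
  move=> qt t0 c0; apply: (mulfI c0); rewrite -qt.
  have := congr1 (fun p => p.[t]) W; rewrite -q3 /L3 /aff !hornerE /= t0; lra.
have [c0|c0] := eqVneq c 0; last first.
  exists (c - l3), (- c * xT - m3); split.
  - by apply: onL => //; rewrite ?subrr ?mul0r // /q /L1 /aff !hornerE /= -y1E; ring.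
  - by lra.
  - by apply: onL => //; rewrite ?subrr ?mulr0 // qE /L2 /aff !hornerE /= -yUE; ring.
  - rewrite L4E.
    have -> : wpoly A B = ('X - x2%:P) * ('X - x3%:P) * ('X - xT%:P) + L3 ^+ 2.
      by rewrite -f3 /L3; ring.
    have -> : ('X - x1%:P) * ('X - xT%:P) * ('X - xU%:P) =
      (('X - x1%:P) * ('X - xU%:P)) * ('X - xT%:P) by ring.
    by rewrite -W; ring.
(* If [c = 0], then [L1] and [L2] are opposite. Comparing roots gives [R = -P] and [U = Q], and the
   line sought is the opposite of [L3]. *)
have W0 t : (t - x2) * (t - x3) = (t - x1) * (t - xU).
  by have := congr1 (fun p => p.[t]) W; rewrite c0 !hornerE /= => <-; ring.
have q0 t : (t - x1) * (t - x2) = (t - x3) * (t - xU).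
  by have := congr1 (fun p => p.[t]) qE; rewrite /q c0 !hornerE /= => h; lra.
have x13 : x1 = x3.
  have /eqP := q0 x3; rewrite subrr mul0r mulf_eq0 !subr_eq0.
  case/orP=> /eqP e //; have /eqP := W0 x1.
  by rewrite subrr mul0r -e -expr2 sqrf_eq0 subr_eq0 => /eqP ->.
have x2U : x2 = xU by have := q0 0; have := q0 1; subst; lra.
have l12 : l2 = - l1 by rewrite -[l2](addKr l1) -/c c0 addr0.
have m12' : m2 = - m1 by rewrite m12 c0; ring.
exists (- l3), (- m3); split.
- by rewrite y1E x13 -[l1]opprK -l12 -[m1]opprK -m12'; lra.
- by lra.
- by rewrite yUE -x2U l12 m12'; lra.
- rewrite (_ : aff (- l3) (- m3) = - L3); last by rewrite /L3 /aff; ring.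
  by rewrite sqrrN f3 x13 x2U; ring.
Qed.

Lemma ec_addA P Q R : on_curve A B P -> on_curve A B Q -> on_curve A B R ->
  ec_add A P (ec_add A Q R) = ec_add A (ec_add A P Q) R.
Proof.
move=> cP cQ cR.
case: P cP => [[x1 y1]|//] cP; case: Q cQ => [[x2 y2]|//] cQ.
case: R cR => [[x3 y3]|] cR; last by rewrite !ec_add0.
have cS := ec_add_curve cP cQ; have cT := ec_add_curve cQ cR.
case ES : (ec_add A (Some (x1, y1)) (Some (x2, y2))) (cS) => [[xS yS]|] {}cS; last first.
  rewrite [RHS]/= (ec_add_eq0 ES) -{1}[Some (x1, y1)]ec_negK ec_addKN //.
  exact: ec_neg_curve.
case ET : (ec_add A (Some (x2, y2)) (Some (x3, y3))) (cT) => [[xT yT]|] {}cT; last first.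
  rewrite ec_add0 (ec_add_eq0 ET) ec_addC -?ES ?ec_neg_curve ?ec_add_curve //.
  by rewrite [ec_add A (Some (x1, y1)) _]ec_addC // ec_addKN.
have LS := line_ec_add cP cQ ES; have LT := line_ec_add cQ cR ET.
have cU := ec_add_curve cS cR.
case EU : (ec_add A (Some (xS, yS)) (Some (x3, y3))) (cU) => [[xU yU]|] {}cU; last first.
  have [eR fR] := ec_add_eq0 EU.
  move: ET; rewrite eR fR (ec_add_line (line3_rot LS)) => -[<- <-].
  by rewrite /= !eqxx opprK eqxx.
have LU := line_ec_add cS cR EU.
rewrite (@ec_add_line _ _ _ _ xU (- yU)) ?opprK //.
apply: (line3_assoc LS LU LT).
(* If [x2 = x3], then [R = Q] because [Q + R] is finite. If moreover [xS = x2], then [S = Q] because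
   [S + R] is finite, and [P + Q = Q] is impossible for an affine [P]. *)
have [e23|//] := eqVneq x2 x3 => /=; subst x3.
have y23 : y3 = y2.
  move: cQ cR => /= /eqP c2 /eqP c3.
  have : (y3 - y2) * (y3 + y2) = 0 by rewrite -subr_sqr c2 c3; ring.
  move/eqP; rewrite mulf_eq0 subr_eq0 addr_eq0 => /orP [/eqP //|/eqP e].
  by move: ET; rewrite /= eqxx e opprK eqxx.
subst y3; rewrite eqxx /=; apply/eqP => eS; subst xS.
have yS2 : yS = y2.
  move: cQ cS => /= /eqP c2 /eqP c3.
  have : (yS - y2) * (yS + y2) = 0 by rewrite -subr_sqr c2 c3; ring.
  move/eqP; rewrite mulf_eq0 subr_eq0 addr_eq0 => /orP [/eqP //|/eqP e].
  by move: EU; rewrite /= eqxx e eqxx.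
subst yS; have := ec_add_line (line3_rot LS).
by rewrite /= eqxx opprK eqxx.
Qed.

End GroupLaw.

(** * The rational points as an abelian group *)

(** The proof [ns] is a parameter of the type so that the group instance, whose associativity
    depends on it, can be inferred. *)
Definition ecpt (A B : rat) (ns : 4 * A ^+ 3 + 27 * B ^+ 2 != 0) : Type :=
  {P : point | on_curve A B P}.

Section ECGroup.
Variables (A B : rat) (ns : 4 * A ^+ 3 + 27 * B ^+ 2 != 0).
Local Notation E := (ecpt ns).

HB.instance Definition _ := SubType.copy E {P : point | on_curve A B P}.
HB.instance Definition _ := Choice.copy E {P : point | on_curve A B P}.

Definition ecpt_zero : E := exist (on_curve A B) None isT.
Definition ecpt_opp (P : E) : E :=
  exist (on_curve A B) (ec_neg (val P)) (ec_neg_curve (valP P)).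
Definition ecpt_add (P Q : E) : E :=
  exist (on_curve A B) (ec_add A (val P) (val Q)) (ec_add_curve (valP P) (valP Q)).

Lemma ecpt_addA : associative ecpt_add.
Proof. by move=> P Q R; apply/val_inj; rewrite /= (ec_addA ns) // valP. Qed.
Lemma ecpt_addC : commutative ecpt_add.
Proof. by move=> P Q; apply/val_inj; rewrite /= (ec_addC ns) // valP. Qed.
Lemma ecpt_add0 : left_id ecpt_zero ecpt_add.
Proof. by move=> P; apply/val_inj. Qed.
Lemma ecpt_addN : left_inverse ecpt_zero ecpt_opp ecpt_add.
Proof. by move=> P; apply/val_inj; rewrite /= ec_addN. Qed.

HB.instance Definition _ :=
  GRing.isZmodule.Build E ecpt_addA ecpt_addC ecpt_add0 ecpt_addN.

Lemma val_ecptD (P Q : E) : val (P + Q) = ec_add A (val P) (val Q).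
Proof. by []. Qed.

Lemma val_ecptN (P : E) : val (- P) = ec_neg (val P).
Proof. by []. Qed.

Lemma val_ecptMn (P : E) n : val (P *+ n) = ec_natmul A n (val P).
Proof. by elim: n => [|n IHn] //; rewrite mulrS val_ecptD IHn. Qed.

Lemma val_ecptMz (P : E) m : val (P *~ m) = ec_intmul A m (val P).
Proof.
case: m => n; first exact: val_ecptMn.
by rewrite [in LHS]NegzE mulrNz -pmulrn val_ecptN val_ecptMn.
Qed.

End ECGroup.

(** * Reduction modulo 3 *)

Lemma dvdz3E (z : int) : (3 %| z)%Z = (z%:~R == 0 :> 'F_3).
Proof. by apply: dvdz_pcharf; apply: pchar_Fp. Qed.

(** Reducing the fraction [n / d] cancels no factor 3 when [n] is prime to 3. *)
Lemma pow3_dvdz_denq (x : rat) (d n : int) (e : nat) :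
  x * d%:~R = n%:~R -> ((3 ^ e)%N %| d)%Z -> ~~ (3 %| n)%Z ->
  ((3 ^ e)%N %| denq x)%Z.
Proof.
move=> xd ed n3.
have E : numq x * d = n * denq x.
  by apply: (@intr_inj rat); rewrite !intrM numqE mulrAC xd.
rewrite -(@Gauss_dvdzr _ n); first by rewrite -E dvdz_mull.
by rewrite coprimezE /= coprimeXl // prime_coprime.
Qed.

Lemma dvd3_num_den (x : rat) : (3 %| numq x)%Z -> (3 %| denq x)%Z -> False.
Proof.
move=> h1 h2; have := coprime_num_den x; rewrite /coprime.
have : (3 %| gcdn `|numq x| `|denq x|)%N by rewrite dvdn_gcd; apply/andP.
by move=> h /eqP e; rewrite e in h.
Qed.

(** Expanding [gcdn u b ^ 2] and replacing [b ^ 2] by [u * v] lets [u] be factored out; the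
    remaining gcd divides [gcdn u v = 1]. *)
Lemma coprime_sqr (u v b : nat) : coprime u v -> (u * v = b ^ 2)%N ->
  (u = gcdn u b ^ 2)%N.
Proof.
move=> cuv e.
have k : gcdn (gcdn u b) (gcdn b v) = 1%N.
  apply/eqP; rewrite -dvdn1 -(eqP cuv) dvdn_gcd.
  rewrite (dvdn_trans (dvdn_gcdl _ _) (dvdn_gcdl _ _)).
  by rewrite (dvdn_trans (dvdn_gcdr _ _) (dvdn_gcdr _ _)).
rewrite -mulnn muln_gcdl !muln_gcdr [X in gcdn _ (gcdn _ X)]mulnn -e (mulnC b u).
by rewrite -!muln_gcdr k muln1.
Qed.

(** * Duplication and tripling formulas *)

Lemma ec_double_x A x y x' y' :
  ec_add A (Some (x, y)) (Some (x, y)) = Some (x', y') ->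
  y != 0 /\ x' * (4 * y ^+ 2) = (3 * x ^+ 2 + A) ^+ 2 - 8 * x * y ^+ 2.
Proof.
rewrite /= eqxx /=; have [//|ny] := eqVneq y (- y) => /= -[<- _].
have y0 : y != 0 by apply: contra_neq ny => ->; rewrite oppr0.
by split=> //; field.
Qed.

Lemma ec_add_chord (A x1 y1 x2 y2 : rat) : x1 != x2 ->
  let l := (y2 - y1) / (x2 - x1) in
  exists y3, ec_add A (Some (x1, y1)) (Some (x2, y2)) = Some (l ^+ 2 - x1 - x2, y3).
Proof. by move=> ne l; rewrite /= (negbTE ne) /=; eexists. Qed.

(** The third division polynomial. *)
Definition psi3 (A B x : rat) : rat :=
  3 * x ^+ 4 + 6 * A * x ^+ 2 + 12 * B * x - A ^+ 2.

(** This is [x(3P) = x - psi_2 psi_4 / psi_3^2] with denominators cleared; the sextic is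
    [psi_4 / (4 y)]. *)
Lemma ec_triple_x A B x y :
  on_curve A B (Some (x, y)) -> y != 0 -> psi3 A B x != 0 ->
  exists x' y', ec_add A (Some (x, y)) (ec_add A (Some (x, y)) (Some (x, y)))
     = Some (x', y') /\
   x' * psi3 A B x ^+ 2 = x * psi3 A B x ^+ 2 - 8 * (x ^+ 3 + A * x + B) *
     (x ^+ 6 + 5 * A * x ^+ 4 + 20 * B * x ^+ 3 - 5 * A ^+ 2 * x ^+ 2
      - 4 * A * B * x - 8 * B ^+ 2 - A ^+ 3).
Proof.
move=> /= /eqP c y0; rewrite eqxx /=.
have ny : y != - y by apply: contra_neq y0; lra.
rewrite (negbTE ny) /=; set l := _ / (2 * y).
have AE : A = 2 * y * l - 3 * x ^+ 2 by rewrite /l; field.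
have BE : B = y ^+ 2 - x ^+ 3 - A * x by rewrite c; ring.
(* The last factor is [x(P) - x(2P)], so [P] and [2P] are joined by a genuine chord. *)
have -> : psi3 A B x = 4 * y ^+ 2 * (3 * x - l ^+ 2).
  by rewrite /psi3 BE AE; ring.
rewrite !mulf_eq0 !negb_or => /andP [_ d0].
have nx : x != l ^+ 2 - x - x by apply: contra_neq d0; lra.
rewrite (negbTE nx) /=; set l2 := _ / _; exists (l2 ^+ 2 - x - (l ^+ 2 - x - x)).
eexists; split; first by [].
have d1 : (l ^+ 2 - x - x) - x != 0 by apply: contra_neq d0; lra.
by rewrite BE AE /l2; field.
Qed.

Lemma Ecoef_AE (a : nat) : Ecoef_A a = (- (a%:Z ^+ 2))%:~R.
Proof. by rewrite /Ecoef_A rmorphN rmorphXn /= pmulrn. Qed.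

Lemma Ecoef_BE (b : nat) : Ecoef_B b = (b%:Z ^+ 2)%:~R.
Proof. by rewrite /Ecoef_B rmorphXn /= pmulrn. Qed.

(** Denominator and numerator of the duplication formula at [x = u / w] with [B = 0]. The first
    vanishes since [u^3 = u]; the second is [(u^2 + w^2)^2], and -1 is not a square modulo 3. *)
Lemma doubling_mod3 (u w A : 'F_3) : A = -1 -> ~~ ((u == 0) && (w == 0)) ->
  4 * w * (u ^+ 3 + A * u * w ^+ 2) = 0 /\
  u ^+ 4 - 2 * A * u ^+ 2 * w ^+ 2 + A ^+ 2 * w ^+ 4 != 0.
Proof.
by move=> ->; case: u w => [[|[|[|i]]] //= iu] [[|[|[|j]]] //= jw] // _;
  split=> //; apply/eqP.
Qed.

Lemma numqE_div (x : rat) : x = (numq x)%:~R / (denq x)%:~R.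
Proof. by rewrite divq_num_den. Qed.

(** * Powers of 3 in the denominators of doubles and triples *)

Section ThreeAdic.
Variables A B : int.
Hypothesis (A3 : A%:~R = -1 :> 'F_3) (B3 : B%:~R = 0 :> 'F_3).
Local Notation AQ := (A%:~R : rat).
Local Notation BQ := (B%:~R : rat).

Lemma denq_double x y x' y' :
  on_curve AQ BQ (Some (x, y)) ->
  ec_add AQ (Some (x, y)) (Some (x, y)) = Some (x', y') -> (3 %| denq x')%Z.
Proof.
move=> /eqP c /ec_double_x [y0].
rewrite c [in X in X -> _](numqE_div x).
set u := numq x; set w := denq x => h.
have w0 : w%:~R != 0 :> rat by rewrite intr_eq0 denq_neq0.
have nz : ~~ ((u%:~R == 0 :> 'F_3) && (w%:~R == 0 :> 'F_3)).
  by rewrite -!dvdz3E; apply/negP => /andP []; apply: dvd3_num_den.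
have [d0 n0] := doubling_mod3 A3 nz.
(* The duplication formula at [x = u / w], scaled by [w^4]. *)
apply: (@pow3_dvdz_denq _ (4 * w * (u ^+ 3 + A * u * w ^+ 2 + B * w ^+ 3))
  (u ^+ 4 - 2 * A * u ^+ 2 * w ^+ 2 - 8 * B * u * w ^+ 3 + A ^+ 2 * w ^+ 4) 1).
- move/(congr1 (fun t => t * w%:~R ^+ 4)): h.
  rewrite !(rmorphM, rmorphD, rmorphN, rmorphXn) /= => h.
  apply: etrans (etrans h _); field; exact: w0.
- by rewrite expn1 dvdz3E !(rmorphM, rmorphD, rmorphN, rmorphXn) /= B3 mul0r addr0 d0.
- by rewrite dvdz3E !(rmorphM, rmorphD, rmorphN, rmorphXn) /= B3 mulr0 !mul0r subr0 n0.
Qed.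

Lemma denq_triple x y :
  on_curve AQ BQ (Some (x, y)) -> (3 %| denq x)%Z ->
  exists x' y', ec_add AQ (Some (x, y)) (ec_add AQ (Some (x, y)) (Some (x, y)))
     = Some (x', y') /\ (logn 3 `|denq x| < logn 3 `|denq x'|)%N.
Proof.
move=> c w3.
have w0 : (denq x)%:~R != 0 :> rat by rewrite intr_eq0 denq_neq0.
have u3 : ~~ (3 %| numq x)%Z by apply/negP => u3; apply: dvd3_num_den u3 w3.
set u := numq x in u3; set w := denq x in w0 w3 *.
have xE : x = u%:~R / w%:~R by rewrite -numqE_div.
have w3' : w%:~R = 0 :> 'F_3 by apply/eqP; rewrite -dvdz3E.
have y0 : y != 0.
  (* With [y = 0] the homogenized cubic equation would read [u^3 = 0] modulo 3. *)
  apply: contraNneq u3 => y0; move: c => /eqP; rewrite y0 expr0n /= xE => h.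
  have : u ^+ 3 + A * u * w ^+ 2 + B * w ^+ 3 = 0.
    apply: (@intr_inj rat); move/(congr1 (fun t => t * w%:~R ^+ 3)): h.
    rewrite mul0r !(rmorphM, rmorphD, rmorphN, rmorphXn) /= => h.
    by rewrite [RHS]h; field.
  move/(congr1 (intr : int -> 'F_3)).
  rewrite !(rmorphM, rmorphD, rmorphN, rmorphXn) /= w3' !expr0n /= !mulr0 !addr0.
  by move/eqP; rewrite dvdz3E expf_eq0.
pose Psi := 3 * u ^+ 4 + 6 * A * u ^+ 2 * w ^+ 2 + 12 * B * u * w ^+ 3 - A ^+ 2 * w ^+ 4.
have PsiE : Psi%:~R = psi3 AQ BQ x * w%:~R ^+ 4.
  by rewrite /psi3 xE !(rmorphM, rmorphD, rmorphN, rmorphXn) /=; field.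
have /dvdzP [k wE] := w3.
(* Substituting [w = 3 k] shows that 3 divides [Psi] exactly once, since [u] is prime to 3; in
   particular [Psi] is nonzero. *)
have PsiE3 : Psi = (u ^+ 4 + (6 * A * u ^+ 2 * k ^+ 2 + 36 * B * u * k ^+ 3
    - 9 * A ^+ 2 * k ^+ 4) * 3) * 3 by rewrite /Psi wE; ring.
have Psi3 : (3 %| Psi)%Z by rewrite PsiE3 dvdz_mull.
have Psi0 : Psi != 0.
  apply: contraNneq u3 => /eqP; rewrite PsiE3 mulf_eq0 orbF addr_eq0 => /eqP u4.
  have : (3 %| u ^+ 4)%Z by rewrite u4 -mulNr dvdz_mull.
  by rewrite !dvdz3E rmorphXn expf_eq0.
clearbody Psi.
have psi0 : psi3 AQ BQ x != 0.
  by move: Psi0; apply: contra_neq => h; apply: (@intr_inj rat); rewrite PsiE h mul0r.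
have [x' [y' [E h]]] := ec_triple_x c y0 psi0.
exists x', y'; split => //.
pose e := logn 3 `|w|.
have wpos : (0 < `|w|)%N by rewrite absz_gt0 denq_neq0.
have : ((3 ^ e.+1)%N %| denq x')%Z.
  pose F := A * u * w + B * w ^+ 2.
  pose G := 5 * A * u ^+ 4 * w + 20 * B * u ^+ 3 * w ^+ 2
    - 5 * A ^+ 2 * u ^+ 2 * w ^+ 3 - 4 * A * B * u * w ^+ 4
    - 8 * B ^+ 2 * w ^+ 5 - A ^+ 3 * w ^+ 5.
  (* The tripling formula scaled by [w^9]. The factor [Psi^2] adds powers of 3 to those of [w],
     while the numerator is [u^9] modulo 3. *)
  apply: (@pow3_dvdz_denq _ (w * Psi ^+ 2)
    (u * Psi ^+ 2 - 8 * (u ^+ 3 + w * F) * (u ^+ 6 + w * G))).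
  - rewrite !(rmorphB, rmorphM, rmorphD, rmorphN, rmorphXn) /= PsiE.
    move/(congr1 (fun t => t * w%:~R ^+ 9)): h.
    set p := psi3 _ _ _; rewrite xE => h.
    apply: etrans (etrans h _); first by ring.
    by field.
  - rewrite expnSr PoszM; apply: dvdz_mul; last by rewrite expr2 dvdz_mulr.
    by rewrite dvdzE /= pfactor_dvdnn.
  - have /dvdzP [p pE] := Psi3.
    have -> : u * Psi ^+ 2 - 8 * (u ^+ 3 + w * F) * (u ^+ 6 + w * G) =
        u ^+ 9 + (3 * u * p ^+ 2 - 3 * u ^+ 9
          - 8 * k * (F * u ^+ 6 + u ^+ 3 * G + w * F * G)) * 3.
      by clearbody F G; rewrite pE wE; ring.
    apply: contra u3 => n3; have : (3 %| u ^+ 9)%Z.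
      by move: n3; rewrite rpredDr // dvdz_mull.
    by rewrite !dvdz3E rmorphXn expf_eq0.
by rewrite dvdzE /= pfactor_dvdn // absz_gt0 denq_neq0.
Qed.

End ThreeAdic.

(** * Absence of torsion *)

Section Torsion.
Variables (A B : int).
Hypothesis (A3 : A%:~R = -1 :> 'F_3) (B3 : B%:~R = 0 :> 'F_3).
Hypothesis ns : 4 * (A%:~R : rat) ^+ 3 + 27 * (B%:~R : rat) ^+ 2 != 0.
Hypothesis no2 : forall x : rat, ~~ on_curve A%:~R B%:~R (Some (x, 0)).
Local Notation E := (ecpt ns).

Lemma ecpt_double_eq0 (P : E) : P + P = 0 -> P = 0.
Proof.
move=> PP; apply/val_inj; move/(congr1 val): PP; rewrite val_ecptD.
have := valP P; case: (val P) => [[x y]|//] c /=.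
rewrite eqxx /=; case: eqP => //= yN _.
have y0 : y = 0 by lra.
by move: c; rewrite y0 (negbTE (no2 x)).
Qed.

Lemma denq_ecpt_double (Q : E) x y :
  val (Q + Q) = Some (x, y) -> (3 %| denq x)%Z.
Proof.
rewrite val_ecptD; have := valP Q; case: (val Q) => [[u v]|//] c.
exact: denq_double c.
Qed.

(** The value 0 at infinity makes [0 < den3 P] single out the affine points that reduce to
    infinity. *)
Definition den3 (P : E) : nat :=
  if val P is Some (x, _) then logn 3 `|denq x| else 0.

Lemma den3_triple (P : E) : (0 < den3 P)%N -> (den3 P < den3 (P *+ 3))%N.
Proof.
rewrite /den3 !mulrS mulr0n addr0 !val_ecptD.
have := valP P; case: (val P) => [[x y]|//] c.
rewrite logn_gt0 mem_primes => /andP [_ /andP [_ d3]].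
by have [x' [y' [-> lt]]] := denq_triple c d3.
Qed.

(* Tripling increases [den3], so the multiples of [R] take infinitely many values. *)
Lemma den3_torsion (R : E) n : (0 < den3 R)%N -> (0 < n)%N -> R *+ n <> 0.
Proof.
move=> dR n0 Rn.
have Rmod k : R *+ (k %% n) = R *+ k.
  by rewrite {2}(divn_eq k n) mulrnDr mulnC mulrnA Rn mul0rn add0r.
have lt k : (k %% n < n)%N by rewrite ltn_mod.
pose m (i : 'I_n) := den3 (R *+ i).
(* Among the finitely many multiples one maximizes [den3]. Comparison with [R] makes this maximum
   positive, and tripling then exceeds it. *)
case: (@arg_maxnP _ (Ordinal n0) xpredT m isT) => i _ imax.
have i0 : (0 < den3 (R *+ i))%N.
  apply: leq_trans (imax (Ordinal (lt 1%N)) isT).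
  by rewrite /m /= Rmod.
have := imax (Ordinal (lt (i * 3)%N)) isT.
by rewrite /m /= Rmod leqNgt mulrnA den3_triple.
Qed.

Lemma ecpt_torsion_free (P : E) n : (0 < n)%N -> P *+ n = 0 -> P = 0.
Proof.
move=> n0 Pn; apply: ecpt_double_eq0; apply/eqP; apply/negPn/negP => PP0.
apply: (@den3_torsion (P + P) n) => //; last by rewrite mulrnDl Pn addr0.
rewrite /den3; case Q : (val (P + P)) => [[x y]|]; last first.
  by case/eqP: PP0; apply: val_inj.
have := denq_ecpt_double Q; rewrite logn_gt0 mem_primes => d3.
by rewrite absz_gt0 denq_neq0.
Qed.

Lemma torsion_trivial_of_mod3 : torsion_trivial A%:~R B%:~R.
Proof.
move=> P cP [n [n0 Pn]].
pose P' : E := exist (on_curve A%:~R B%:~R) P cP.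
have /(congr1 val) // : P' = 0.
by apply: (ecpt_torsion_free n0); apply: val_inj; rewrite val_ecptMn.
Qed.

(** The fraction [n / d] need not be reduced, so abscissas can be used as computed. *)
Lemma ecpt_not_double (T Q : E) x y (d n : int) :
  val T = Some (x, y) -> x * d%:~R = n%:~R -> ~~ (3 %| d)%Z -> T <> Q + Q.
Proof.
move=> Tx xd d3 TQ.
have x3 : (3 %| denq x)%Z by apply: (@denq_ecpt_double Q x y); rewrite -TQ.
apply: (@dvd3_num_den x) => //.
have e : numq x * d = n * denq x.
  by apply: (@intr_inj rat); rewrite !intrM numqE mulrAC xd.
have : (3 %| numq x * d)%Z by rewrite e dvdz_mull.
by rewrite !dvdz3E intrM mulf_eq0 -!dvdz3E (negbTE d3) orbF.
Qed.

End Torsion.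

(** * Independence from non-divisibility by 2 *)

(** Floor division sends -1 to -1, so the decrease is strict only for even nonzero [n]. *)
Lemma int_halve (n : int) : exists (k : int) (e : bool),
  [/\ n = k + k + e%:Z, (`|k| <= `|n|)%N & ~~ e -> n != 0 -> (`|k| < `|n|)%N].
Proof.
exists (n %/ 2)%Z, ((n %% 2)%Z == 1); split; lia.
Qed.

(** Infinite descent: by the second hypothesis the coefficients of a relation are all even, and
    without 2-torsion the relation can be halved. *)
Lemma indep_of_not_double (G : zmodType) (P1 P2 P3 : G) :
  (forall Q : G, Q + Q = 0 -> Q = 0) ->
  (forall (e1 e2 e3 : bool) Q,
     P1 *+ e1 + (P2 *+ e2 + P3 *+ e3) = Q + Q -> ~~ [|| e1, e2 | e3]) ->
  forall n1 n2 n3 : int, P1 *~ n1 + (P2 *~ n2 + P3 *~ n3) = 0 ->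
  [/\ n1 = 0, n2 = 0 & n3 = 0].
Proof.
move=> no2 nd n1 n2 n3.
have [N] := ubnP (`|n1| + `|n2| + `|n3|)%N.
elim: N n1 n2 n3 => // N IHN n1 n2 n3 leN s0.
have [k1 [e1 [n1E le1 lt1]]] := int_halve n1.
have [k2 [e2 [n2E le2 lt2]]] := int_halve n2.
have [k3 [e3 [n3E le3 lt3]]] := int_halve n3.
pose S := P1 *~ k1 + (P2 *~ k2 + P3 *~ k3).
have SE : P1 *+ e1 + (P2 *+ e2 + P3 *+ e3) + (S + S) = 0.
  rewrite -s0 n1E n2E n3E !mulrzDr -!pmulrn /S.
  rewrite [X in _ + X](addrACA (P1 *~ k1)) (addrACA (P2 *~ k2)).
  by rewrite [LHS]addrC [LHS]addrACA; congr (_ + _); exact: addrACA.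
have : ~~ [|| e1, e2 | e3].
  apply: (nd e1 e2 e3 (- S)); rewrite -opprD.
  by move/eqP: SE; rewrite addr_eq0 => /eqP.
rewrite !negb_or => /and3P [f1 f2 f3].
have S0 : S = 0.
  by apply: no2; rewrite -SE (negbTE f1) (negbTE f2) (negbTE f3) !mulr0n !add0r.
have [z1|nz] := boolP [&& n1 == 0, n2 == 0 & n3 == 0].
  by case/and3P: z1 => /eqP -> /eqP -> /eqP ->.
have [] := IHN k1 k2 k3 _ S0; last first.
  by move=> k10 k20 k30; split; lia.
lia.
Qed.

(** * No point of order 2 and no torsion on the given curves *)

(** Modulo 8, [b^2] is 1, [a^2] is 1 or 4, and [g^2] is 0, 1 or 4, which leaves a finite check. *)
Lemma cubic_mod8 (a b g e : 'Z_8) : odd b -> ~~ (4 %| a)%N ->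
  (e == 1) || (e == -1) -> (e * g ^+ 2) ^+ 3 - a ^+ 2 * (e * g ^+ 2) + b ^+ 2 != 0.
Proof.
move=> ob a4 e1.
have b2 : b ^+ 2 = 1.
  by apply/eqP; case: b ob => [[|[|[|[|[|[|[|[|j]]]]]]]] //= jb].
have a2 : (a ^+ 2 == 1) || (a ^+ 2 == 4%:R).
  by case: a a4 => [[|[|[|[|[|[|[|[|j]]]]]]]] //= jb].
have g2 : [|| g ^+ 2 == 0, g ^+ 2 == 1 | g ^+ 2 == 4%:R].
  by case: g => [[|[|[|[|[|[|[|[|j]]]]]]]] //= jb].
rewrite b2; case/orP: e1 => /eqP ->; case/orP: a2 => /eqP ->;
  by case/or3P: g2 => /eqP ->.
Qed.

Lemma PoszX2 (n : nat) : (n ^ 2)%N%:Z = n%:Z ^+ 2.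
Proof. by rewrite -mulnn PoszM. Qed.

Section Curve.
Variables a b : nat.
Hypotheses (cab : coprime a b) (ob : odd b) (b3 : (3 %| b)%N) (a4 : ~~ (4 %| a)%N).

Lemma cubic_no_int_root (u : int) : u ^+ 3 - a%:Z ^+ 2 * u + b%:Z ^+ 2 <> 0.
Proof.
move=> h.
(* The factors are coprime because a common prime would divide both [u] and [a], whereas [u] divides
   [b^2]. *)
have prod : (`|u| * `|a%:Z ^+ 2 - u ^+ 2| = b ^ 2)%N.
  rewrite -abszM; have -> : u * (a%:Z ^+ 2 - u ^+ 2) = (b ^ 2)%N%:Z.
    by rewrite -[RHS]addr0 -oppr0 -h PoszX2; ring.
  by [].
have cua : coprime `|u| a.
  apply: (@coprime_dvdl _ (b ^ 2)); first by rewrite -prod dvdn_mulr.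
  by rewrite coprimeXl // coprime_sym.
have cuv : coprime `|u| `|a%:Z ^+ 2 - u ^+ 2|.
  rewrite -coprimezE /coprimez (_ : _ - _ = (- u) * u + a%:Z ^+ 2); last by ring.
  by rewrite gcdzMDl -/(coprimez _ _) coprimezE abszX coprimeXr.
have := coprime_sqr cuv prod; set g := gcdn _ _ => uE.
have {uE} [e [e1 uE]] : exists e : int, ((e == 1) || (e == -1)) /\ u = e * g%:Z ^+ 2.
  have [u0|u0] := leP 0 u; [exists 1 | exists (-1)]; split=> //.
    by rewrite mul1r -PoszX2 -uE gez0_abs.
  by rewrite mulN1r -PoszX2 -uE ltz0_abs ?opprK.
have e1' : (e%:~R == 1 :> 'Z_8) || (e%:~R == -1 :> 'Z_8).
  by case/orP: e1 => /eqP ->.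
have oZ : odd (b%:R : 'Z_8) by rewrite val_Zp_nat // odd_mod.
have aZ : ~~ (4 %| (a%:R : 'Z_8))%N.
  by rewrite val_Zp_nat //; apply: contra a4; rewrite /dvdn modn_dvdm.
case/eqP: (cubic_mod8 g%:R oZ aZ e1').
move/(congr1 (intr : int -> 'Z_8)): h; rewrite uE.
rewrite !(rmorphB, rmorphM, rmorphD, rmorphN, rmorphXn) /= => h.
by apply: etrans h; rewrite -!pmulrn; ring.
Qed.

Lemma no_two_torsion (x : rat) : ~~ on_curve (Ecoef_A a) (Ecoef_B b) (Some (x, 0)).
Proof.
apply/negP => /eqP; rewrite expr0n /= Ecoef_AE Ecoef_BE.
set A := (- _)%R; set B := (b%:Z ^+ 2)%R.
set u := numq x; set w := denq x => h0.
have w0 : w%:~R != 0 :> rat by rewrite intr_eq0 denq_neq0.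
have h : u ^+ 3 + A * u * w ^+ 2 + B * w ^+ 3 = 0.
  apply: (@intr_inj rat); move/(congr1 (fun t => t * w%:~R ^+ 3)): h0.
  clearbody A B; rewrite mul0r [in X in X -> _](numqE_div x) -/u -/w.
  rewrite !(rmorphM, rmorphD, rmorphN, rmorphXn) /= => h0.
  by rewrite [RHS]h0; field.
(* Rational root argument: the cubic is monic, so [w] divides [u^3]. *)
have w1 : w = 1.
  have : (`|w| %| `|u| ^ 3)%N.
    rewrite -abszX; have -> : u ^+ 3 = - (A * u * w + B * w ^+ 2) * w.
      by rewrite -[LHS]addr0 -oppr0 -h; ring.
    by rewrite abszM dvdn_mull.
  have c : coprime `|w| (`|u| ^ 3) by rewrite coprimeXr // coprime_sym coprime_num_den.
  move=> /gcdn_idPl e; rewrite -[w](gtz0_abs (denq_gt0 x)).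
  by congr Posz; rewrite -e; apply/eqP.
apply: (@cubic_no_int_root u); rewrite -[RHS]h w1 /A /B; ring.
Qed.

Lemma Ecoef_a_not_dvd3 : ~~ (3 %| a)%N.
Proof.
apply/negP => a3; have : (3 %| gcdn a b)%N by rewrite dvdn_gcd a3.
by rewrite (eqP cab).
Qed.

Lemma Ecoef_A_mod3 : (- (a%:Z ^+ 2))%:~R = -1 :> 'F_3.
Proof.
rewrite rmorphN rmorphXn /=; congr (- _).
have : a%:Z%:~R != 0 :> 'F_3 by rewrite -dvdz3E dvdzE Ecoef_a_not_dvd3.
by case: (a%:Z%:~R) => [[|[|[|i]]] // ?] _; apply/eqP.
Qed.

Lemma Ecoef_B_mod3 : (b%:Z ^+ 2)%:~R = 0 :> 'F_3.
Proof.
apply/eqP; rewrite rmorphXn expf_eq0 /= -dvdz3E; exact: b3.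
Qed.

(** A zero discriminant would mean [4 a^6 = 27 b^4], whose right side is odd. *)
Lemma Ecoef_nonsingular :
  4 * (- (a%:Z ^+ 2))%:~R ^+ 3 + 27 * (b%:Z ^+ 2)%:~R ^+ 2 != 0 :> rat.
Proof.
apply/eqP => h.
have {}h : (4 * a ^ 6 = 27 * b ^ 4)%N.
  apply/eqP; rewrite -(eqr_nat rat) natrM natrX natrM natrX; apply/eqP.
  move: h; rewrite rmorphN !rmorphXn /= -!pmulrn; lra.
by have := congr1 odd h; rewrite [odd (27 * _)]oddM [odd (4 * _)]oddM (oddX b) ob.
Qed.

Lemma Ecoef_torsion_trivial : torsion_trivial (Ecoef_A a) (Ecoef_B b).
Proof.
rewrite Ecoef_AE Ecoef_BE.
apply: (torsion_trivial_of_mod3 Ecoef_A_mod3 Ecoef_B_mod3 Ecoef_nonsingular).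
by rewrite -Ecoef_AE -Ecoef_BE; apply: no_two_torsion.
Qed.
End Curve.

(** * Curves attached to the Pell equation *)

Section Pell.
Variables a b : nat.
Hypotheses (pell : (a ^ 2 = 3 * b ^ 2 + 1)%N) (ob : odd b) (b3 : (3 %| b)%N).
Hypothesis a3 : (a %% 3 = 2)%N.

Lemma pell_coprime : coprime a b.
Proof.
rewrite /coprime -dvdn1; have := pell => /(congr1 (dvdn (gcdn a b))).
rewrite -!mulnn [in LHS]dvdn_mulr ?dvdn_gcdl // dvdn_addr; first by move<-.
by rewrite dvdn_mull // dvdn_mulr // dvdn_gcdr.
Qed.

(** An odd [b] has [b^2 = 1] modulo 8, so [3 b^2 + 1] is 4 modulo 8. *)
Lemma pell_not4 : ~~ (4 %| a)%N.
Proof.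
clear b3 a3; apply/negP => /dvdnP [k aE]; pose m := b./2.
have bE : (b = 2 * m + 1)%N by rewrite -[LHS]odd_double_half ob -/m -mul2n addnC.
have [t tE] : exists t, (m * m.+1 = t * 2)%N.
  by apply/dvdnP; rewrite dvdn2 oddM /= andbN.
have b2 : (b ^ 2 = 8 * t + 1)%N by rewrite bE -mulnn; lia.
have a2 : (a ^ 2 = 16 * (k * k))%N by rewrite aE -mulnn; lia.
by move: pell; rewrite a2 b2; lia.
Qed.

Lemma pell_rat : (a%:R ^+ 2 = 3 * b%:R ^+ 2 + 1 :> rat).
Proof. by rewrite -!natrX pell natrD natrM. Qed.

(* Doubles lie on the unbounded real component of the curve. *)
Lemma double_x_gt0 x y x' y' :
  on_curve (Ecoef_A a) (Ecoef_B b) (Some (x, y)) ->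
  ec_add (Ecoef_A a) (Some (x, y)) (Some (x, y)) = Some (x', y') -> 0 < x'.
Proof.
move=> /eqP c /ec_double_x [y0 h].
have y2 : 0 < 4 * y ^+ 2 by rewrite mulr_gt0 // exprn_even_gt0.
rewrite -(pmulr_lgt0 _ y2) h c /Ecoef_A /Ecoef_B.
have ha := pell_rat; set a' := a%:R in ha *; set b' := b%:R in ha *.
have a1 : 1 <= a' ^+ 2 by rewrite ha; have := sqr_ge0 b'; lra.
have b2 := sqr_ge0 b'.
have -> : (3 * x ^+ 2 - a' ^+ 2) ^+ 2 - 8 * x * (x ^+ 3 + - a' ^+ 2 * x + b' ^+ 2) =
   x ^+ 4 + 2 * a' ^+ 2 * x ^+ 2 + a' ^+ 2 * a' ^+ 2 - 8 * b' ^+ 2 * x by ring.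
have x4 : 0 <= x ^+ 4 by rewrite exprn_even_ge0.
have a4 : 0 < a' ^+ 2 * (a' ^+ 2 - 8 / 9) by apply: mulr_gt0; lra.
have [x0|x0] := leP x 0.
  have h1 : 0 <= b' ^+ 2 * (- x) by rewrite mulr_ge0 //; lra.
  have h2 : 0 <= a' ^+ 2 * x ^+ 2 by rewrite mulr_ge0 ?sqr_ge0.
  lra.
(* With [b^2 = (a^2 - 1) / 3] the numerator is [x^4 + 2 a^2 (x - 2/3)^2 + a^2 (a^2 - 8/9) + 8 x /
   3]. *)
have h1 : 0 <= a' ^+ 2 * (x - 2 / 3) ^+ 2 by rewrite mulr_ge0 ?sqr_ge0.
have -> : b' ^+ 2 = (a' ^+ 2 - 1) / 3 by lra.
lra.
Qed.

Let A := (- (a%:Z ^+ 2))%R.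
Let B := (b%:Z ^+ 2)%R.
Let ns := Ecoef_nonsingular a ob.
Local Notation E := (ecpt ns).
Let ra : rat := a%:R.
Let rb : rat := b%:R.

Lemma a_ge2 : 2 <= ra.
Proof. by rewrite /ra (ler_nat _ 2); move: a3; case: (a) => [|[]]. Qed.

Lemma curve_P1 : on_curve A%:~R B%:~R (Some (0, rb)).
Proof. by rewrite -Ecoef_AE -Ecoef_BE; apply/eqP; rewrite /Ecoef_A /Ecoef_B -/rb; ring. Qed.
Lemma curve_P2 : on_curve A%:~R B%:~R (Some (ra, rb)).
Proof. by rewrite -Ecoef_AE -Ecoef_BE; apply/eqP; rewrite /Ecoef_A /Ecoef_B -/rb -/ra; ring. Qed.
Lemma curve_P3 : on_curve A%:~R B%:~R (Some (-1, 2 * rb)).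
Proof.
rewrite -Ecoef_AE -Ecoef_BE; apply/eqP; rewrite /Ecoef_A /Ecoef_B pell_rat -/rb; ring.
Qed.

Let P1 : E := exist (on_curve A%:~R B%:~R) _ curve_P1.
Let P2 : E := exist (on_curve A%:~R B%:~R) _ curve_P2.
Let P3 : E := exist (on_curve A%:~R B%:~R) _ curve_P3.

(* Reduction modulo 3 excludes all the combinations except [P2 + P3], which has a
   negative abscissa. *)
Lemma pell_not_double (e1 e2 e3 : bool) (Q : E) :
  P1 *+ e1 + (P2 *+ e2 + P3 *+ e3) = Q + Q -> ~~ [|| e1, e2 | e3].
Proof.
have A3 := Ecoef_A_mod3 pell_coprime b3; have B3 := Ecoef_B_mod3 b3.
have ra2 := a_ge2; have pr := pell_rat; rewrite -/ra -/rb in pr.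
have nd := ecpt_not_double A3 B3.
have raE : ra = a%:Z%:~R by rewrite /ra pmulrn.
have rbE : rb = b%:Z%:~R by rewrite /rb pmulrn.
case: e1 e2 e3 => [] [] [] //=; rewrite ?mulr1n ?mulr0n ?addr0 ?add0r => TQ.
- have ne1 : 0 != ra by apply/eqP; lra.
  have v12 : val (P1 + P2) = Some (- ra, - rb).
    rewrite val_ecptD /= (negbTE ne1) /= subrr mul0r.
    by congr Some; congr pair; ring.
  have ne2 : - ra != -1 by apply/eqP; lra.
  have [y3 E3] := ec_add_chord A%:~R (- rb) (2 * rb) ne2.
  rewrite addrA in TQ.
  (* The chord from [(-a, -b)] to [(-1, 2b)] has slope [3b / (a - 1)], and [a - 1] is prime to 3. *)
  exfalso; apply: (nd ns _ Q _ y3 ((a%:Z - 1) ^+ 2) (9 * b%:Z ^+ 2 + (a%:Z + 1) * (a%:Z - 1) ^+ 2) _ _ _ TQ).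
  + by rewrite val_ecptD v12 E3.
  + rewrite raE rbE !(rmorphB, rmorphM, rmorphD, rmorphN, rmorphXn) /= -raE -rbE.
    by field; apply/eqP; lra.
  + by rewrite dvdz3E rmorphXn expf_eq0 /= -dvdz3E; lia.
- have ne1 : 0 != ra by apply/eqP; lra.
  have [y3 E3] := ec_add_chord A%:~R rb rb ne1.
  exfalso; apply: (nd ns _ Q _ y3 1 (- a%:Z) _ _ _ TQ) => //; first by rewrite val_ecptD E3.
  by rewrite rmorphN /= -raE subrr mul0r; ring.
- have ne1 : 0 != -1 :> rat by [].
  have [y3 E3] := ec_add_chord A%:~R rb (2 * rb) ne1.
  exfalso; apply: (nd ns _ Q _ y3 1 (b%:Z ^+ 2 + 1) _ _ _ TQ) => //; first by rewrite val_ecptD E3.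
  by rewrite rmorphD rmorphXn /= -rbE; field.
- exfalso; apply: (nd ns P1 Q 0 rb 1 0 erefl _ _ TQ) => //; by rewrite mul0r.
(* Here [a + 1] is divisible by 3, so positivity of doubles is used: [3 (a + 1)] times the abscissa
   is [-(a - 1)(3a + 2)]. *)
- have ne1 : ra != -1 by apply/eqP; lra.
  have [y3 E3] := ec_add_chord A%:~R rb (2 * rb) ne1.
  move/(congr1 val): TQ; rewrite !val_ecptD E3.
  have := valP Q; case: (val Q) => [[x y]|//] c /esym h.
  move: c h; rewrite -Ecoef_AE -Ecoef_BE => c h.
  have := double_x_gt0 c h.
  have d0 : 0 < 3 * (ra + 1) by lra.
  rewrite -(pmulr_lgt0 _ d0).
  have -> : (((2 * rb - rb) / (-1 - ra)) ^+ 2 - ra - -1) * (3 * (ra + 1)) =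
    (3 * rb ^+ 2 + 1 - 1) / (ra + 1) + 3 * (1 - ra) * (ra + 1).
    by field; apply/andP; split; apply/eqP; lra.
  rewrite -pr; have -> : (ra ^+ 2 - 1) / (ra + 1) = ra - 1 by field; apply/eqP; lra.
  have h1 : 0 < (ra - 1) * ra by apply: mulr_gt0; lra.
  by move=> h2; have : (0 : rat) < 0 by lra.
- exfalso; apply: (nd ns P2 Q ra rb 1 a%:Z erefl _ _ TQ) => //; by rewrite mulr1.
- exfalso; apply: (nd ns P3 Q (-1) (2 * rb) 1 (-1) erefl _ _ TQ) => //; by rewrite mulr1.
Qed.

Lemma pell_rank_ge3 : rank_ge3 (Ecoef_A a) (Ecoef_B b).
Proof.
rewrite Ecoef_AE Ecoef_BE; exists (val P1), (val P2), (val P3).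
split; try exact: valP; move=> n1 n2 n3.
rewrite -!(@val_ecptMz _ _ ns) -!val_ecptD => s0.
have no2 x : ~~ on_curve A%:~R B%:~R (Some (x, 0)).
  by rewrite -Ecoef_AE -Ecoef_BE no_two_torsion ?pell_coprime ?pell_not4.
apply: (indep_of_not_double (@ecpt_double_eq0 _ _ ns no2) pell_not_double).
exact: val_inj.
Qed.
End Pell.

(** * Infinitely many suitable Pell solutions *)

Lemma pell_unbounded N : exists a b : nat,
  [/\ (N < a)%N, (a ^ 2 = 3 * b ^ 2 + 1)%N, odd b, (3 %| b)%N & (a %% 3 = 2)%N].
Proof.
elim: N => [|N [a [b [lt pell ob b3 a3]]]]; first by exists 26%N, 15%N.
(* The components of [(a + b sqrt 3)^3]. Since [a^2 + b^2 = 4 b^2 + 1] is odd and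
   [a^2 + 9 b^2 = 12 b^2 + 1] is 1 modulo 3, the congruences persist. *)
exists (a * (a ^ 2 + 9 * b ^ 2))%N, (3 * b * (a ^ 2 + b ^ 2))%N; split.
- have b0 : (0 < b)%N by case: (b) ob.
  have b2 : (0 < b ^ 2)%N by rewrite expn_gt0 b0.
  by apply: (@leq_trans (a * 2)); [lia | rewrite leq_mul2l; lia].
- by rewrite !expnMn pell; move: (b ^ 2)%N => s; ring.
- rewrite oddM [odd (3 * b)]oddM ob pell.
  by rewrite (_ : 3 * _ + 1 + _ = (b ^ 2).*2.*2.+1)%N /= ?odd_double //; lia.
- by rewrite -mulnA dvdn_mulr.
- rewrite pell (_ : a * _ = 4 * a * b ^ 2 * 3 + a)%N ?modnMDl //.
  by move: (b ^ 2)%N => s; ring.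
Qed.

(** Infinitude is expressed by pairs with [a] beyond any bound [N]. *)
Theorem theorem1p1 :
  (forall a b : nat, (0 < a)%N -> (0 < b)%N -> coprime a b -> odd b ->
     (3 %| b)%N -> ~~ (4 %| a)%N ->
     torsion_trivial (Ecoef_A a) (Ecoef_B b))
  /\
  (forall N : nat, exists a b : nat,
     [/\ (N < a)%N, (0 < a)%N, (0 < b)%N /\ (a ^ 2 = 3 * b ^ 2 + 1)%N,
         rank_ge3 (Ecoef_A a) (Ecoef_B b)
       & torsion_trivial (Ecoef_A a) (Ecoef_B b)]).
Proof.
split=> [a b _ _ cab ob b3 a4|N]; first exact: Ecoef_torsion_trivial.
have [a [b [ltNa pell ob b3 a3]]] := pell_unbounded N.
exists a, b; split=> //.
- exact: leq_ltn_trans ltNa.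
- by split=> //; case: (b) ob.
- exact: pell_rank_ge3.
- apply: Ecoef_torsion_trivial => //; first exact: pell_coprime.
  exact: pell_not4 pell ob.
Qed.
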